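(* For $m\in\{4,5\}$, \[ \gamma^{\mathrm{SID}}(K_m\times P_n)=\begin{cases}2m+6,& n=5,\\ 4m,& n=6.\end{cases} \]
   Context: For a vertex $v$, $N[v]$ is its closed neighborhood. A nonempty set $S\subseteq V(G)$ is a self-identifying code of $G$ if for every vertex $v\in V(G)$: (1) $N[v]\cap S\neq\emptyset$, and (2) $\bigcap_{c\in N[v]\cap S}N[c]=\{v\}$; $\gamma^{\mathrm{SID}}(G)$ is the minimum size of such a code. With $V(K_m)=\{v_0,\dots,v_{m-1}\}$ and $V(P_n)=\{0,\dots,n-1\}$ (consecutively numbered path), the direct product $K_m\times P_n$ has vertices $(v_i,j)$, with $(v_i,j)$ adjacent to $(v_{i'},j')$ iff $i\neq i'$ and $|j-j'|=1$. *)

(* Defs.v *)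
From HB Require Import structures.
From mathcomp Require Import all_boot.

Set Implicit Arguments.
Unset Strict Implicit.
Unset Printing Implicit Defensive.

Record sgraph := SGraph {
  vertex :> finType;
  edge : rel vertex;
  edge_sym : symmetric edge;
  edge_irrefl : irreflexive edge
}.

Definition closed_nbhd (G : sgraph) (v : G) : {set G} :=
  [set u | (u == v) || edge v u].

Definition self_identifying (G : sgraph) (S : {set G}) : Prop :=
  S != set0 /\
  forall v : G,
    closed_nbhd v :&: S != set0 /\
    \bigcap_(c in closed_nbhd v :&: S) closed_nbhd c = [set v].

(* A self-identifying code need not exist (e.g. when two distinct vertices have
   the same closed neighbourhood), so "gamma^SID(G) = k" is a relation, which
   includes the existence of a code. *)
Definition gammaSID_is (G : sgraph) (k : nat) : Prop :=
  (exists2 S : {set G}, self_identifying S & #|S| = k) /\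
  (forall S : {set G}, self_identifying S -> k <= #|S|).

Definition complete_rel (m : nat) : rel 'I_m := fun i j => i != j.

Fact complete_sym m : symmetric (@complete_rel m).
Proof. by move=> i j; rewrite /complete_rel eq_sym. Qed.

Fact complete_irrefl m : irreflexive (@complete_rel m).
Proof. by move=> i; rewrite /complete_rel eqxx. Qed.

Definition complete_graph (m : nat) : sgraph :=
  SGraph (@complete_sym m) (@complete_irrefl m).

Definition path_rel (n : nat) : rel 'I_n :=
  fun i j => (i.+1 == j :> nat) || (j.+1 == i :> nat).

Fact path_sym n : symmetric (@path_rel n).
Proof. by move=> i j; rewrite /path_rel orbC. Qed.

Fact path_irrefl n : irreflexive (@path_rel n).
Proof. by move=> i; rewrite /path_rel orbb gtn_eqF. Qed.

Definition path_graph (n : nat) : sgraph :=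
  SGraph (@path_sym n) (@path_irrefl n).

Definition direct_rel (G H : sgraph) : rel (G * H)%type :=
  fun x y => edge x.1 y.1 && edge x.2 y.2.

Fact direct_sym G H : symmetric (@direct_rel G H).
Proof.
by move=> x y; rewrite /direct_rel edge_sym; congr (_ && _); exact: edge_sym.
Qed.

Fact direct_irrefl G H : irreflexive (@direct_rel G H).
Proof. by move=> x; rewrite /direct_rel edge_irrefl. Qed.

Definition direct_product (G H : sgraph) : sgraph :=
  SGraph (@direct_sym G H) (@direct_irrefl G H).

(* Main.v *)
Require Import Defs.
From HB Require Import structures.
From mathcomp Require Import all_boot zify.

(** A code [S] is self-identifying iff for all [v != u] some codeword of [N[v]]
    lies outside [N[u]]. Write [s_j] for the number of codewords in column [j].
    In an end column, separating [(i, j)] from [(i, j'')], two columns away,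
    forces [(i, j)] to be a codeword, so the column is full; separating [(i, j)]
    from the vertices [(k, j')] of the next column forces that column to contain
    at least three codewords. For [n = 5] this already gives [2m + 6].

    For [n = 6], if column 2 or column 3 is full then the total is at least
    [3m + 6 >= 4m]. Otherwise, separating a non-codeword [(i, j)] from the other
    vertices of column [j] shows that the columns [j - 1] and [j + 1] together
    cover all [k != i]. Hence [s_1 + s_3 >= m] unless some [k] is missing in
    both, in which case [s_1 + s_3 >= m - 1] and [(k, 2)] is the only
    non-codeword of column 2, so that [s_2 + s_4 >= (m - 1) + 3]; the same holds
    for [s_2 + s_4] with column 3. The codes attaining the bounds are explicit. *)

Set Implicit Arguments.
Unset Strict Implicit.
Unset Printing Implicit Defensive.

(** * Self-identification as pairwise separation *)

Section Separation.
Variable G : sgraph.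
Implicit Types (S : {set G}) (u v c : G).

Lemma in_closed_nbhd u v : (u \in closed_nbhd v) = (u == v) || edge v u.
Proof. by rewrite inE. Qed.

Lemma self_identifying_separates S v u :
    self_identifying S -> u != v ->
  exists c, [/\ c \in S, (c == v) || edge v c & ~~ ((c == u) || edge u c)].
Proof.
case=> _ /(_ v) [_ capE] neq_uv.
have: u \notin \bigcap_(c in closed_nbhd v :&: S) closed_nbhd c.
  by rewrite capE inE.
move=> u_out; have [/existsP[c /and3P[Sc vc uc]]|/existsPn no_c] :=
  boolP [exists c, [&& c \in S, (c == v) || edge v c & ~~ ((c == u) || edge u c)]].
  by exists c.
case/negP: u_out; apply/bigcapP => c; rewrite !inE => /andP[vc Sc].
by have := no_c c; rewrite Sc vc /= negbK eq_sym edge_sym.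
Qed.

(** Domination comes for free: as [G] has a second vertex [u], the codeword separating [v] from [u]
    already lies in the closed neighbourhood of [v]. *)
Lemma separates_self_identifying S :
    1 < #|G| ->
    (forall v u, u != v ->
      exists c, [/\ c \in S, (c == v) || edge v c & ~~ ((c == u) || edge u c)]) ->
  self_identifying S.
Proof.
move=> G_gt1 sepS.
have domS v : exists c, c \in closed_nbhd v :&: S.
  have /card_gt0P[u] : 0 < #|[set~ v]| by rewrite cardsC1; lia.
  by rewrite !inE => /sepS[c [Sc vc _]]; exists c; rewrite !inE vc.
split=> [|v].
  have /card_gt0P[v _] : 0 < #|G| by lia.
  by have [c /setIP[_ Sc]] := domS v; apply/set0Pn; exists c.
split; first by apply/set0Pn; exact: domS.
apply/setP=> u; rewrite inE; have [->|neq_uv] := eqVneq u v.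
  by apply/bigcapP=> c /setIP[]; rewrite !in_closed_nbhd eq_sym edge_sym.
have [c [Sc vc uc]] := sepS _ _ neq_uv; apply/negbTE; apply/bigcapP => /(_ c).
by rewrite !inE vc Sc => /(_ isT); rewrite eq_sym edge_sym (negbTE uc).
Qed.

End Separation.

(** * Codewords in single columns *)

Notation KP m n := (direct_product (complete_graph m) (path_graph n)).

Section Columns.
Variables m n : nat.
Implicit Types (S : {set KP m n}) (i k : 'I_m) (j : 'I_n).

Definition column S j : {set 'I_m} := [set i | (i, j) \in S].

Lemma card_columns S : #|S| = \sum_(j < n) #|column S j|.
Proof.
under eq_bigr do rewrite -sum1dep_card.
rewrite -sum1_card (exchange_big_dep predT) //= pair_big_dep /=.
by apply: eq_bigl => -[i j].
Qed.

(** Every neighbour of [(i, j)] lies in column [j'] and is adjacent to [(i, j'')] too, so only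
    [(i, j)] itself can separate the two. *)
Lemma end_column_full S j j' j'' :
    self_identifying S ->
    path_rel j j' -> path_rel j' j'' ->
    j'' != j -> (forall y, path_rel j y -> y = j') ->
  #|column S j| = m.
Proof.
move=> sidS jj' j'j'' neq_jj'' j_end.
suff -> : column S j = setT by rewrite cardsT card_ord.
apply/setP=> i; rewrite !inE.
have [|[x y] [Sc vc uc]] :=
  @self_identifying_separates (KP m n) S (i, j) (i, j'') sidS.
  by apply: contraNneq neq_jj'' => -[->].
case/orP: vc => [/eqP<- //|/andP[/= ix /j_end y_j']]; case/negP: uc.
by rewrite /= /direct_rel /= y_j' path_sym j'j'' andbT ix orbT.
Qed.

(** Since [(i, j)] is adjacent to [(k, j')] for [k != i], a codeword separating them is some
    [(x, j')] with [x] different from [i] and [k]. Hence no two indices exhaust column [j']. *)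
Lemma next_column_ge3 S j j' :
    1 < m -> self_identifying S -> path_rel j j' ->
    (forall y, path_rel j y -> y = j') ->
  3 <= #|column S j'|.
Proof.
move=> m_gt1 sidS jj' j_end.
have third i k : k != i -> exists2 x, x \in column S j' & (x != i) && (x != k).
  move=> neq_ki.
  have [|[x y] [Sc vc uc]] :=
    @self_identifying_separates (KP m n) S (i, j) (k, j') sidS.
    by apply: contraNneq neq_ki => -[->].
  case/orP: vc => [/eqP xy|/andP[/= ix /j_end y_j']].
    case/negP: uc; rewrite xy /= /direct_rel /=.
    by rewrite path_sym jj' andbT /complete_rel neq_ki orbT.
  exists x; first by rewrite inE -y_j'.
  rewrite eq_sym [i == x]negbTE //=; apply: contraNneq uc => xk.
  by rewrite xk y_j' eqxx.
have ord01 : Ordinal m_gt1 != Ordinal (ltnW m_gt1) by [].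
have [a Sa _] := third _ _ ord01.
have [k neq_ka] : exists k, k != a.
  by case: (eqVneq a (Ordinal m_gt1)) => [->|]; [exists (Ordinal (ltnW m_gt1))|
    exists (Ordinal m_gt1); rewrite eq_sym].
have [b Sb /andP[neq_ba _]] := third _ _ neq_ka.
have [c Sc /andP[neq_ca neq_cb]] := third _ _ neq_ba.
have <- : #|c |: [set a; b]| = 3.
  by rewrite cardsU1 cards2 !inE negb_or neq_ca neq_cb eq_sym neq_ba.
by apply/subset_leq_card/subsetP => x /setU1P[->//|/set2P[]->].
Qed.

(** A neighbour [(x, y)] of [(i, j)] with [x != k] is also adjacent to [(k, j)], so the separating
    codeword has [x = k]. *)
Lemma noncodeword_neighbours S a j b i k :
    self_identifying S ->
    (forall y, path_rel j y -> y = a \/ y = b) ->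
    i \notin column S j -> k != i -> k \in column S a :|: column S b.
Proof.
move=> sidS j_nbrs; rewrite inE => Sij neq_ki.
have [|[x y] [Sc vc uc]] :=
  @self_identifying_separates (KP m n) S (i, j) (k, j) sidS.
  by apply: contraNneq neq_ki => -[->].
case/orP: vc => [/eqP xy|/andP[/= ix jy]]; first by rewrite -xy Sc in Sij.
have xk : x = k.
  apply/eqP; apply: contraNT uc => neq_xk; apply/orP; right.
  by rewrite /= /direct_rel /= jy andbT /complete_rel eq_sym.
by rewrite -xk !inE; case: (j_nbrs y jy) => <-; rewrite Sc ?orbT.
Qed.

Lemma noncodeword_column_bound S a j b :
    self_identifying S ->
    (forall y, path_rel j y -> y = a \/ y = b) ->
    #|column S j| < m ->
  m <= #|column S a| + #|column S b| \/
  m.-1 <= #|column S a| + #|column S b| /\ m.-1 <= #|column S j|.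
Proof.
move=> sidS j_nbrs Sj_lt.
set U := column S a :|: column S b.
have leU : #|U| <= #|column S a| + #|column S b| by rewrite cardsU leq_subr.
have nbrs i k := @noncodeword_neighbours S a j b i k sidS j_nbrs.
have cover_but_one (k : 'I_m) (A : {set 'I_m}) :
    (forall i, i != k -> i \in A) -> m.-1 <= #|A|.
  move=> kA; rewrite -[m in m.-1]card_ord -(cardsC1 k).
  by apply/subset_leq_card/subsetP => i; rewrite !inE => /kA.
have [UT|/forallPn[k Uk]] := boolP [forall k, k \in U].
  left; apply: leq_trans leU; rewrite -[leqLHS]card_ord -cardsT.
  by apply/subset_leq_card/subsetP => k _; exact: (forallP UT).
right; split.
  have /forallPn[i Si] : ~~ [forall i, i \in column S j].
    apply: contraL Sj_lt => /forallP Sj; rewrite -leqNgt.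
    rewrite -[leqLHS]card_ord -cardsT.
    by apply/subset_leq_card/subsetP => i _.
  by apply: leq_trans leU; apply: (cover_but_one i) => x; exact: nbrs Si.
(* A non-codeword [(i, j)] with [i != k] would force [k] into [U]. *)
apply: (cover_but_one k) => i neq_ik; apply: contraR Uk => Si.
by apply: nbrs Si _; rewrite eq_sym.
Qed.

End Columns.

(** * Columns numbered by naturals, and the lower bounds *)

Lemma card_columns_nat m n (S : {set KP m n.+1}) :
  #|S| = \sum_(0 <= j < n.+1) #|column S (inord j)|.
Proof. by rewrite big_mkord card_columns; under [RHS]eq_bigr do rewrite inord_val. Qed.

Lemma path_rel_inord n a b : a < n.+1 -> b < n.+1 ->
  path_rel (inord a : 'I_n.+1) (inord b) = (a.+1 == b) || (b.+1 == a).
Proof. by move=> an bn; rewrite /path_rel !inordK. Qed.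

(** The truncated [a.-1] at [a = 0] and the out-of-range [inord a.+1] at [a = n] are default values;
    those alternatives are never reached. *)
Lemma path_rel_inordl n a (y : 'I_n.+1) : a < n.+1 -> path_rel (inord a) y ->
  y = inord a.-1 \/ y = inord a.+1.
Proof.
move=> an; rewrite /path_rel inordK // => /orP[]/eqP ya; [right|left].
  by rewrite ya inord_val.
by rewrite -ya inord_val.
Qed.

Lemma path_rel_first n (y : 'I_n.+1) : path_rel (inord 0) y -> y = inord 1.
Proof. by rewrite /path_rel inordK // orbF => /eqP->; rewrite inord_val. Qed.

Lemma path_rel_last n (y : 'I_n.+1) : path_rel (inord n) y -> y = inord n.-1.
Proof.
rewrite /path_rel inordK // => /orP[]/eqP yn; first by have := ltn_ord y; lia.
by rewrite (_ : n.-1 = y) ?inord_val //; lia.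
Qed.

Lemma inord_neq n a b : a < n.+1 -> b < n.+1 -> a != b ->
  (inord a : 'I_n.+1) != inord b.
Proof. by move=> an bn; rewrite -val_eqE /= !inordK. Qed.

Lemma outer_columns m n (S : {set KP m n.+3}) :
    1 < m -> self_identifying S ->
  [/\ #|column S (inord 0)| = m, 3 <= #|column S (inord 1)|,
      3 <= #|column S (inord n.+1)| & #|column S (inord n.+2)| = m].
Proof.
move=> m_gt1 sidS; split.
- apply: (end_column_full (j' := inord 1) (j'' := inord 2)) => //.
  + by rewrite path_rel_inord.
  + by rewrite path_rel_inord.
  + by rewrite inord_neq.
  + exact: path_rel_first.
- apply: (next_column_ge3 (j := inord 0)) => //; last exact: path_rel_first.
  by rewrite path_rel_inord.
- apply: (next_column_ge3 (j := inord n.+2)) => //; last exact: path_rel_last.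
  by rewrite path_rel_inord // eqxx orbT.
- apply: (end_column_full (j' := inord n.+1) (j'' := inord n)) => //.
  + by rewrite path_rel_inord // eqxx orbT.
  + by rewrite path_rel_inord ?eqxx ?orbT //; lia.
  + by rewrite inord_neq //; lia.
  + exact: path_rel_last.
Qed.

Lemma sid_KP5_lower m (S : {set KP m 5}) :
  1 < m -> self_identifying S -> 2 * m + 6 <= #|S|.
Proof.
move=> m_gt1 sidS; have [] := outer_columns m_gt1 sidS.
rewrite card_columns_nat !big_nat_recr // big_geq //=; lia.
Qed.

Lemma sid_KP6_lower m (S : {set KP m 6}) :
  1 < m <= 6 -> self_identifying S -> 4 * m <= #|S|.
Proof.
case/andP=> m_gt1 m_le6 sidS; have [] := outer_columns m_gt1 sidS.
have := @noncodeword_column_bound _ _ S (inord 1) (inord 2) (inord 3) sidS.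
move=> /(_ (fun y => @path_rel_inordl 5 2 y isT)).
have := @noncodeword_column_bound _ _ S (inord 2) (inord 3) (inord 4) sidS.
move=> /(_ (fun y => @path_rel_inordl 5 3 y isT)).
(* The bound [m <= 6] settles the case of a full column 2 or 3, where [3 * m + 6] must reach
   [4 * m]. *)
rewrite card_columns_nat !big_nat_recr // big_geq //=; lia.
Qed.

(** * Explicit codes, verified by computation *)

Section ExplicitCodes.
Variables m n : nat.
Variable f : nat -> nat -> bool.

Definition code_of : {set KP m n} := [set v : 'I_m * 'I_n | f v.2 v.1].

Lemma card_code_of : #|code_of| = sumn [seq count (f j) (iota 0 m) | j <- iota 0 n].
Proof.
rewrite card_columns sumnE big_map -[n in iota 0 n]subn0 big_mkord.
apply: eq_bigr => j _; rewrite -val_enum_ord count_map -size_filter cardE.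
rewrite enumT /enum_mem -!enumT; congr size.
by apply: eq_filter => i /=; rewrite !inE.
Qed.

(** Adjacency on pairs of naturals instead of ordinals, so that [vm_compute] can decide
    separation. *)
Let adjb (x y : nat * nat) :=
  (x.1 != y.1) && ((x.2.+1 == y.2) || (y.2.+1 == x.2)).

Definition separating_codeb :=
  let V := [seq (i, j) | i <- iota 0 m, j <- iota 0 n] in
  all (fun v => all (fun u => (u != v) ==>
    has (fun c => [&& f c.2 c.1, (c == v) || adjb v c &
                     ~~ ((c == u) || adjb u c)]) V) V) V.

Lemma code_of_self_identifying :
  1 < m * n -> separating_codeb -> self_identifying code_of.
Proof.
move=> mn_gt1 sepf; apply: separates_self_identifying.
  by rewrite card_prod !card_ord.
move=> v u neq_uv.
pose p (x : KP m n) : nat * nat := (val x.1, val x.2).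
have pV x : p x \in [seq (i, j) | i <- iota 0 m, j <- iota 0 n].
  by apply/allpairsP; exists (p x); rewrite /= !mem_iota !ltn_ord.
have p_eq x y : (p x == p y) = (x == y).
  by case: x y => [x1 x2] [y1 y2]; rewrite /p /= !xpair_eqE.
have := allP (allP sepf _ (pV v)) _ (pV u).
rewrite p_eq neq_uv => /hasP[_ /allpairsP[[i j] [/= iP jP ->]]].
rewrite mem_iota /= in iP; rewrite mem_iota /= in jP.
have -> : (i, j) = p (Ordinal iP, Ordinal jP) by [].
rewrite !p_eq => /and3P[fc vc uc]; exists (Ordinal iP, Ordinal jP).
by split=> //; rewrite inE.
Qed.

End ExplicitCodes.

(** With column 2 empty, columns 1 and 3 must together contain every index; the first three and the
    last three do so for [m <= 6]. *)
Definition code5 m j i :=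
  match j with
  | 1 => i < 3
  | 2 => false
  | 3 => m <= i + 3
  | _ => true
  end.

(** Columns 1 and 3 are complementary, and so are 2 and 4, so each pair has exactly [m]
    codewords. *)
Definition code6 j i :=
  match j with
  | 1 | 4 => i < 3
  | 2 | 3 => 3 <= i
  | _ => true
  end.

Theorem theoremA3 (m : nat) (hm : m = 4 \/ m = 5) :
  gammaSID_is (direct_product (complete_graph m) (path_graph 5)) (2 * m + 6) /\
  gammaSID_is (direct_product (complete_graph m) (path_graph 6)) (4 * m).
Proof.
split; split; first exists (code_of m 5 (code5 m)).
- by apply: code_of_self_identifying; case: hm => ->; vm_compute.
- by rewrite card_code_of; case: hm => ->; vm_compute.
- by move=> S; apply: sid_KP5_lower; lia.
- exists (code_of m 6 code6); last by rewrite card_code_of; case: hm => ->; vm_compute.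
  by apply: code_of_self_identifying; case: hm => ->; vm_compute.
- by move=> S; apply: sid_KP6_lower; lia.
Qed.
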